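(* Let $\nu$ be a Borel probability measure on $\mathbb{R}$ with support $\Omega\subseteq[0,1]$, and suppose $\nu$ is an R-spectral measure with an R-spectrum $\Gamma$ such that $q\Gamma\subseteq\mathbb{Z}$ for some integer $q\ge1$. Let $\mathcal{C}$ be a finite set of nonnegative integers, $P=\{p_c\}_{c\in\mathcal{C}}$ with $p_c>0$, $\sum_cp_c=1$, and let $\eta_q=\sum_{c\in\mathcal{C}}p_c\delta_{qc}$. Then $\mu:=\eta_q*\nu$ is an R-spectral measure.
   Context: A probability measure $\rho$ on $\mathbb{R}$ is an R-spectral measure with R-spectrum $\Lambda$ if $\{e^{2\pi i\lambda x}:\lambda\in\Lambda\}$ is a Riesz basis of $L^2(\rho)$ (a basis that is also a frame: there exist $A,B>0$ with $A\|f\|^2\le\sum_\lambda|\int fe^{-2\pi i\lambda x}d\rho|^2\le B\|f\|^2$ for all $f$). $*$ denotes convolution of measures. *)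

(* Defs.v *)
From HB Require Import structures.
From mathcomp Require Import all_boot all_order all_algebra.
From mathcomp Require Import all_classical all_reals all_analysis.
Set Implicit Arguments. Unset Strict Implicit. Unset Printing Implicit Defensive.
Import Order.TTheory GRing.Theory Num.Theory.
Import numFieldNormedType.Exports.
Local Open Scope classical_set_scope.
Local Open Scope ring_scope.

(* Complex-valued functions R -> C are represented as pairs (real part,
   imaginary part) : R -> R * R.  All measures live on the Borel measurable
   type R (canonical structure of mathcomp-analysis). *)

Section Defs.
Variable R : realType.
Implicit Types (rho : {measure set R -> \bar R}) (Lam : set R) (f g : R -> R * R).

Definition ang (lam x : R) : R := 2 * pi * lam * x.

Definition cL2 rho f : Prop :=
  [/\ measurable_fun setT (fun x => (f x).1),
      measurable_fun setT (fun x => (f x).2) &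
      (\int[rho]_x (((f x).1) ^+ 2 + ((f x).2) ^+ 2)%:E < +oo)%E].

Definition norm2 rho f : \bar R :=
  (\int[rho]_x (((f x).1) ^+ 2 + ((f x).2) ^+ 2)%:E)%E.

Definition dist2 rho f g : \bar R :=
  norm2 rho (fun x => ((f x).1 - (g x).1, (f x).2 - (g x).2)).

(* real and imaginary parts of  \int f(x) e^{-2 pi i lam x} d rho(x) *)
Definition fcoefRe rho f (lam : R) : R :=
  Rintegral rho setT (fun x => (f x).1 * cos (ang lam x) + (f x).2 * sin (ang lam x)).
Definition fcoefIm rho f (lam : R) : R :=
  Rintegral rho setT (fun x => (f x).2 * cos (ang lam x) - (f x).1 * sin (ang lam x)).

Definition fcoef2 rho f (lam : R) : R := fcoefRe rho f lam ^+ 2 + fcoefIm rho f lam ^+ 2.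

Definition exp_frame rho Lam : Prop :=
  exists A B : R, [/\ 0 < A, 0 < B &
    forall f, cL2 rho f ->
      (A%:E * norm2 rho f <= \esum_(l in Lam) (fcoef2 rho f l)%:E)%E /\
      (\esum_(l in Lam) (fcoef2 rho f l)%:E <= B%:E * norm2 rho f)%E].

(* finite partial sum  \sum_{l in F} c_l e^{2 pi i l x},  c_l = (c l).1 + i (c l).2 *)
Definition psum (c : R -> R * R) (F : seq R) (x : R) : R * R :=
  (\sum_(l <- F) ((c l).1 * cos (ang l x) - (c l).2 * sin (ang l x)),
   \sum_(l <- F) ((c l).1 * sin (ang l x) + (c l).2 * cos (ang l x))).

(* f = \sum_{l in Lam} c_l e_l, the series converging (unconditionally, as a
   net over finite subsets of Lam) in L^2(rho) *)
Definition has_expansion rho Lam f (c : R -> R * R) : Prop :=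
  forall e : R, 0 < e -> exists F0 : seq R,
    (forall l, l \in F0 -> Lam l) /\
    forall F : seq R, uniq F -> (forall l, l \in F -> Lam l) ->
      (forall l, l \in F0 -> l \in F) ->
      (dist2 rho f (psum c F) < e%:E)%E.

Definition exp_basis rho Lam : Prop :=
  forall f, cL2 rho f ->
    (exists c, has_expansion rho Lam f c) /\
    (forall c1 c2, has_expansion rho Lam f c1 -> has_expansion rho Lam f c2 ->
       forall l, Lam l -> c1 l = c2 l).

(* Riesz basis = basis that is also a frame *)
Definition RSpectrum rho Lam : Prop := exp_basis rho Lam /\ exp_frame rho Lam.

Definition RSpectral rho : Prop := exists Lam, RSpectrum rho Lam.

Definition msupport rho : set R :=
  [set x | forall e : R, 0 < e -> (0 < rho (ball x e))%E].

Definition mconv (m1 m2 : set R -> \bar R) (A : set R) : \bar R :=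
  (m1 \x m2)%E [set xy : R * R | A (xy.1 + xy.2)].

End Defs.

(* Main.v *)
(* Since q Gam is contained in Z, every e_g with g in Gam is q-periodic.  With
   t_j = j / (2 q M), M large, and s_c = q c, this gives
     e_(g + t_j) (x + s_c) = e_(t_j) (s_c) e_(t_j) (x) e_g (x),
   where the matrix V = (e_(t_j) (s_c)) is an invertible Vandermonde matrix.  As
   ||f||_mu^2 = \sum_c p_c ||f (. + s_c)||_nu^2, expanding f along the disjoint union
   of the Gam + t_j is the same as expanding along Gam the |C| functions obtained
   from the translates of f by V^-1 and the unimodular factors e_(- t_j); the
   frame inequalities transfer in the same way through V^* diag(p).  *)
Require Import Defs.
From HB Require Import structures.
From mathcomp Require Import all_boot all_order all_algebra.
From mathcomp Require Import all_classical all_reals all_analysis.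
From mathcomp Require Import measurable_realfun complex ring lra zify.
Import Order.TTheory GRing.Theory Num.Theory.
Import numFieldNormedType.Exports.
Local Open Scope classical_set_scope.
Local Open Scope ring_scope.
Local Notation Re := complex.Re.
Local Notation Im := complex.Im.

(** * Complex exponentials and finite quadratic bounds *)

Section ComplexExponentials.
Context {R : realType}.
Implicit Types (z : R[i]) (l x : R).

(** Pairs are moved to [R[i]], where multiplication is the complex one. The squared modulus [nsq]
    stays real-valued, so that it matches the integrand of [norm2]. *)
Definition toC (u : R * R) : R[i] := (u.1 +i* u.2)%C.
Definition ofC z : R * R := (Re z, Im z).
Definition nsq z : R := Re z ^+ 2 + Im z ^+ 2.
Definition cexp l x : R[i] := (cos (ang l x) +i* sin (ang l x))%C.

Lemma ofCK : cancel ofC toC.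
Proof. by case. Qed.

Lemma ReDc z1 z2 : Re (z1 + z2) = Re z1 + Re z2.
Proof. by case: z1 z2 => [a b] [c d]. Qed.

Lemma ImDc z1 z2 : Im (z1 + z2) = Im z1 + Im z2.
Proof. by case: z1 z2 => [a b] [c d]. Qed.

Lemma ReMc z1 z2 : Re (z1 * z2) = Re z1 * Re z2 - Im z1 * Im z2.
Proof. by case: z1 z2 => [a b] [c d]. Qed.

Lemma ImMc z1 z2 : Im (z1 * z2) = Re z1 * Im z2 + Im z1 * Re z2.
Proof. by case: z1 z2 => [a b] [c d]. Qed.

Lemma Re_sum I (r : seq I) (P : pred I) (F : I -> R[i]) :
  Re (\sum_(i <- r | P i) F i) = \sum_(i <- r | P i) Re (F i).
Proof. exact: (big_morph _ ReDc). Qed.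

Lemma Im_sum I (r : seq I) (P : pred I) (F : I -> R[i]) :
  Im (\sum_(i <- r | P i) F i) = \sum_(i <- r | P i) Im (F i).
Proof. exact: (big_morph _ ImDc). Qed.

Lemma nsq_ge0 z : 0 <= nsq z.
Proof. by rewrite addr_ge0 ?sqr_ge0. Qed.

Lemma nsqM z1 z2 : nsq (z1 * z2) = nsq z1 * nsq z2.
Proof. by rewrite /nsq ReMc ImMc; ring. Qed.

Lemma nsqD z1 z2 : nsq (z1 + z2) <= 2 * nsq z1 + 2 * nsq z2.
Proof.
rewrite /nsq ReDc ImDc -subr_ge0.
rewrite [X in 0 <= X](_ : _ = (Re z1 - Re z2) ^+ 2 + (Im z1 - Im z2) ^+ 2);
  last by ring.
by rewrite addr_ge0 ?sqr_ge0.
Qed.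

Lemma nsq_conj z : nsq (conjc z) = nsq z.
Proof. by case: z => a b; rewrite /nsq /= sqrrN. Qed.

Lemma nsq_cexp l x : nsq (cexp l x) = 1.
Proof. exact: cos2Dsin2. Qed.

Lemma mulc_conj z : z * conjc z = (nsq z)%:C%C.
Proof.
by case: z => a b; apply/eqP; rewrite eq_complex /= /nsq /=; apply/andP; split;
  apply/eqP; ring.
Qed.

Lemma cexp_conjK l x : cexp l x * conjc (cexp l x) = 1.
Proof. by rewrite mulc_conj nsq_cexp. Qed.

Lemma cexpDl l1 l2 x : cexp (l1 + l2) x = cexp l1 x * cexp l2 x.
Proof.
rewrite /cexp /ang [2 * pi * _ * x](_ : _ = 2 * pi * l1 * x + 2 * pi * l2 * x);
  last by ring.
by rewrite cosD sinD; apply/eqP; rewrite eq_complex /= eqxx /= addrC.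
Qed.

Lemma cexpDr l x1 x2 : cexp l (x1 + x2) = cexp l x1 * cexp l x2.
Proof.
rewrite /cexp /ang mulrDr cosD sinD.
by apply/eqP; rewrite eq_complex /= eqxx /= addrC.
Qed.

Lemma cexpMn l x n : cexp (n%:R * l) x = cexp l x ^+ n.
Proof.
elim: n => [|n IH].
  by rewrite mul0r /cexp /ang mulr0 mul0r cos0 sin0.
by rewrite -natr1 mulrDl mul1r cexpDl IH exprSr.
Qed.

Lemma toC_psum (c : R -> R * R) (F : seq R) x :
  toC (psum c F x) = \sum_(l <- F) toC (c l) * cexp l x.
Proof. by apply/eqP; rewrite eq_complex Re_sum Im_sum /= !eqxx. Qed.

(** A finite matrix is bounded for weighted Euclidean norms. One row is treated by induction on the
    columns through [nsqD], then the rows are added one by one. Applied pointwise, this gives every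
    norm comparison between a function and its components. *)
Lemma sum_nsq_le m n (v : 'I_m -> R) (w : 'I_n -> R) (A : 'I_m -> 'I_n -> R[i]) :
  (forall k, 0 < w k) ->
  exists2 K : R, 0 < K & forall z : 'I_n -> R[i],
    \sum_j v j * nsq (\sum_k A j k * z k) <= K * \sum_k w k * nsq (z k).
Proof.
move=> w0.
have row (a : 'I_n -> R[i]) : exists2 K : R, 0 < K & forall z : 'I_n -> R[i],
    nsq (\sum_k a k * z k) <= K * \sum_k w k * nsq (z k).
  elim: n w w0 a {A} => [|n IH] w w0 a.
    by exists 1 => // z; rewrite !big_ord0 /nsq /=; lra.
  have [K K0 HK] := IH (w \o lift ord0) (fun=> w0 _) (a \o lift ord0).
  (* The factor 2, here and in [2 * K], comes from [nsqD]; dividing by [w ord0] restores the weight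
     on the right-hand side. *)
  pose L := 2 * nsq (a ord0) / w ord0.
  have L0 : 0 <= L by rewrite divr_ge0 ?mulr_ge0 ?nsq_ge0 // ltW.
  exists (L + 2 * K); first by rewrite ltr_wpDl // mulr_gt0.
  move=> z; rewrite !big_ord_recl; apply: le_trans (nsqD _ _) _.
  rewrite nsqM; have := HK (z \o lift ord0) => /=.
  have -> : 2 * (nsq (a ord0) * nsq (z ord0)) = L * (w ord0 * nsq (z ord0)).
    by rewrite /L; field; rewrite gt_eqF.
  set S := \sum_i _; set T := \sum_i w _ * _ => HS.
  have T0 : 0 <= T by apply: sumr_ge0 => i _; rewrite mulr_ge0 ?nsq_ge0 // ltW.
  have y0 : 0 <= w ord0 * nsq (z ord0) by rewrite mulr_ge0 ?nsq_ge0 // ltW.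
  by nra.
elim: m v A => [|m IH] v A.
  exists 1 => // z; rewrite big_ord0 mul1r.
  by apply: sumr_ge0 => i _; rewrite mulr_ge0 ?nsq_ge0 // ltW.
have [K K0 HK] := IH (v \o lift ord0) (A \o lift ord0).
have [L L0 HL] := row (A ord0).
exists (`|v ord0| * L + K); first by rewrite ltr_wpDl // mulr_ge0 // ltW.
move=> z; rewrite big_ord_recl mulrDl; apply: lerD; last exact: HK.
rewrite -mulrA; apply: le_trans (ler_wpM2l _ (HL z)) => //.
by rewrite ler_wpM2r ?nsq_ge0 // ler_norm.
Qed.

(** * Measurability of complex-valued functions *)

Definition cmeasurable (f : R -> R[i]) : Prop :=
  measurable_fun setT (fun x => Re (f x)) /\
  measurable_fun setT (fun x => Im (f x)).

Lemma cmeasurable_cst z : cmeasurable (cst z).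
Proof. by split; exact: measurable_cst. Qed.

Lemma cmeasurableD f g : cmeasurable f -> cmeasurable g ->
  cmeasurable (fun x => f x + g x).
Proof.
move=> [f1 f2] [g1 g2]; split.
  by under eq_fun do rewrite ReDc; exact: measurable_funD.
by under eq_fun do rewrite ImDc; exact: measurable_funD.
Qed.

Lemma cmeasurableM f g : cmeasurable f -> cmeasurable g ->
  cmeasurable (fun x => f x * g x).
Proof.
move=> [f1 f2] [g1 g2]; split.
  under eq_fun do rewrite ReMc.
  by apply: measurable_funB; exact: measurable_funM.
under eq_fun do rewrite ImMc.
by apply: measurable_funD; exact: measurable_funM.
Qed.

Lemma cmeasurable_sum I (r : seq I) (f : I -> R -> R[i]) :
  (forall i, cmeasurable (f i)) -> cmeasurable (fun x => \sum_(i <- r) f i x).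
Proof.
move=> mf; elim: r => [|i r IH].
  by under eq_fun do rewrite big_nil; exact: cmeasurable_cst.
by under eq_fun do rewrite big_cons; exact: cmeasurableD.
Qed.

Lemma cmeasurable_conj f : cmeasurable f -> cmeasurable (fun x => conjc (f x)).
Proof.
move=> [f1 f2]; split.
  by apply: eq_measurable_fun f1 => x _; case: (f x).
apply: (eq_measurable_fun (fun x => - Im (f x))) => [x _|]; first by case: (f x).
exact: measurableT_comp.
Qed.

Lemma cmeasurableB f g : cmeasurable f -> cmeasurable g ->
  cmeasurable (fun x => f x - g x).
Proof.
move=> mf mg; under eq_fun do rewrite -mulN1r.
by apply: cmeasurableD => //; apply: cmeasurableM => //; exact: cmeasurable_cst.
Qed.

Lemma cmeasurable_shift f s : cmeasurable f -> cmeasurable (fun x => f (x + s)).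
Proof.
have ms : measurable_fun setT (fun x : R => x + s).
  by apply: measurable_funD => //; exact: measurable_cst.
by move=> [f1 f2]; split; [exact: (measurableT_comp f1)|
  exact: (measurableT_comp f2)].
Qed.

Lemma cmeasurable_cexp l : cmeasurable (cexp l).
Proof.
have ma : measurable_fun setT (ang l : R -> R).
  by apply: measurable_funM => //; exact: measurable_cst.
split; apply: (measurableT_comp _ ma).
  by apply: continuous_measurable_fun; exact: continuous_cos.
by apply: continuous_measurable_fun; exact: continuous_sin.
Qed.

Lemma measurable_nsq f : cmeasurable f -> measurable_fun setT (fun x => nsq (f x)).
Proof. by move=> [f1 f2]; apply: measurable_funD; exact: measurable_funX. Qed.

Lemma cmeasurable_psum c F : cmeasurable (fun x => toC (psum c F x)).
Proof.
under eq_fun do rewrite toC_psum.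
apply: cmeasurable_sum => l.
by apply: cmeasurableM; [exact: cmeasurable_cst|exact: cmeasurable_cexp].
Qed.

End ComplexExponentials.

(** * Integrals against the convolution as sums over translates *)

Section TranslateIntegrals.
Context {R : realType}.

(** On measurable sets [eta] agrees with a finite sum of scaled Dirac masses, hence [mu] with the
    sum of the scaled pushforwards of [nu] under the translations by [s k]; integrals against such
    sums split. *)
Lemma integral_conv_discrete {eta nu mu : probability R R} {n : nat}
    {w : 'I_n -> R} {s : 'I_n -> R} :
  (forall k, 0 <= w k) ->
  (forall A, measurable A ->
     eta A = (\sum_(k < n) (w k)%:E * \d_(s k) A)%E) ->
  (forall A, measurable A -> mu A = mconv eta nu A) ->
  forall F : R -> \bar R, measurable_fun setT F -> (forall x, 0 <= F x)%E ->
  (\int[mu]_x F x = \sum_(k < n) (w k)%:E * \int[nu]_x F (x + s k)%R)%E.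
Proof.
move=> w0 etaE muE F mF F0.
(* [msum] takes a family indexed by [nat], so weights and points are extended from ['I_n]; the
   default 0 is only taken at indices from [n] on. *)
pose pick (T : Type) (f : 'I_n -> T) (d : T) (k : nat) :=
  if insub k is Some i then f i else d.
pose W : nat -> {nonneg R} := pick _ (fun k => NngNum (w0 k)) (NngNum (lexx 0)).
pose S := pick _ s 0.
have WE (k : 'I_n) : (W k)%:num = w k by rewrite /W /pick valK.
have SE (k : 'I_n) : S k = s k by rewrite /S /pick valK.
have msh (a : R) : measurable_fun setT (fun x : R => x + a).
  by apply: measurable_funD => //; exact: measurable_cst.
pose M1 (k : nat) := mscale (W k) (\d_(S k) : {measure set R -> \bar R}).
pose N (k : nat) : {measure set R -> \bar R} :=
  measure_function_pushforward__canonical__measure_function_Measure nu (msh (S k)).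
pose M2 (k : nat) := mscale (W k) (N k).
have etaI (g : R -> \bar R) : measurable_fun setT g -> (forall x, 0 <= g x)%E ->
    (\int[eta]_x g x = \sum_(k < n) (w k)%:E * g (s k))%E.
  move=> mg g0; rewrite (eq_measure_integral (msum M1 n)) /=.
    rewrite ge0_integral_measure_sum //; apply: eq_bigr => k _.
    by rewrite ge0_integral_mscale // integral_dirac // diracT mul1e WE SE.
  move=> A mA _; rewrite etaE //; apply: eq_bigr => k _.
  by rewrite -[RHS]/((W k)%:num%:E * \d_(S k) A)%E WE SE.
transitivity (\int[msum M2 n]_x F x)%E; last first.
  rewrite ge0_integral_measure_sum //; apply: eq_bigr => k _.
  rewrite ge0_integral_mscale // WE; congr (_ * _)%E.
  by rewrite ge0_integral_pushforward //= SE.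
apply: eq_measure_integral => A mA _; transitivity (mconv eta nu A); first exact: muE.
rewrite /mconv.
have madd : measurable_fun setT (fun z : R * R => z.1 + z.2).
  by apply: measurable_funD; [exact: measurable_fst|exact: measurable_snd].
have mP : measurable [set xy : R * R | A (xy.1 + xy.2)].
  by rewrite -[X in measurable X]setTI; exact: madd.
(* The product measure integrates the [nu]-measure of the sections against [eta]; the section at
   [s k] is the preimage of [A] under the translation by [s k]. *)
rewrite /product_measure1 etaI //; last exact: measurable_fun_xsection.
apply: eq_bigr => k _.
rewrite -[RHS]/((W k)%:num%:E * nu ((fun x : R => (x + S k)%R) @^-1` A))%E WE SE.
congr (_ * nu _)%E.
by apply/seteqP; split => y; rewrite /xsection /= inE /= addrC.
Qed.

(** The formula for nonnegative functions is applied to the positive and negative parts.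
    Integrability under [mu] passes to the weighted sums of translates under [nu], which allows the
    two integrals to be subtracted. This serves for Fourier coefficients. *)
Lemma Rintegral_translates {nu mu : {measure set R -> \bar R}}
    {n : nat} {w : 'I_n -> R} {s : 'I_n -> R} :
  (forall k, 0 <= w k) ->
  (forall F : R -> \bar R, measurable_fun setT F -> (forall x, 0 <= F x)%E ->
  (\int[mu]_x F x = \sum_(k < n) (w k)%:E * \int[nu]_x F (x + s k)%R)%E) ->
  forall F : R -> R, mu.-integrable setT (EFin \o F) ->
  Rintegral mu setT F = Rintegral nu setT (fun x => \sum_(k < n) w k * F (x + s k)).
Proof.
move=> w0 muI.
pose T (F : R -> R) x := \sum_(k < n) w k * F (x + s k).
have msh (a : R) : measurable_fun setT (fun x : R => x + a).
  by apply: measurable_funD => //; exact: measurable_cst.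
have mT (F : R -> R) : measurable_fun setT F -> measurable_fun setT (T F).
  move=> mF; apply: measurable_sum => k.
  apply: measurable_funM; first exact: measurable_cst.
  exact: measurableT_comp (msh _).
have pos (F : R -> R) : measurable_fun setT F -> (forall x, 0 <= F x) ->
    (\int[mu]_x (F x)%:E = \int[nu]_x (T F x)%:E)%E.
  move=> mF F0; rewrite (muI (EFin \o F)); [|exact/measurable_EFinP|by move=> x; rewrite lee_fin].
  under [RHS]eq_integral do rewrite /T -sumEFin.
  have mk (k : 'I_n) : measurable_fun setT (fun x : R => F (x + s k)) 
    by exact: measurableT_comp (msh _).
  rewrite ge0_integral_sum //.
  - apply: eq_bigr => k _; under [RHS]eq_integral do rewrite EFinM.
    rewrite ge0_integralZl_EFin //; first by move=> x _; rewrite lee_fin.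
    exact/measurable_EFinP.
  - move=> k; apply/measurable_EFinP; apply: measurable_funM => //.
  - by move=> k x _; rewrite lee_fin mulr_ge0.
move=> F iF; have /measurable_EFinP mF := measurable_int _ iF.
pose Fp x := Num.max (F x) 0; pose Fn x := Num.max (- F x) 0.
have mFp : measurable_fun setT Fp by apply: measurable_maxr => //; exact: measurable_cst.
have mFn : measurable_fun setT Fn.
  by apply: measurable_maxr; [exact: measurableT_comp|exact: measurable_cst].
have Fp0 x : 0 <= Fp x by rewrite le_max lexx orbT.
have Fn0 x : 0 <= Fn x by rewrite le_max lexx orbT.
have FE x : F x = Fp x - Fn x.
  by rewrite /Fp /Fn; case: (leP (F x) 0); case: (leP (- F x) 0); lra.
have iP (G : R -> R) : measurable_fun setT G -> (forall x, 0 <= G x) -> (forall x, G x <= `|F x|) ->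
    mu.-integrable setT (EFin \o G) /\ nu.-integrable setT (EFin \o T G).
  move=> mG G0 GF.
  have iG : mu.-integrable setT (EFin \o G).
    apply: le_integrable iF => //; first exact/measurable_EFinP.
    by move=> x _; rewrite /= lee_fin ger0_norm.
  split=> //; apply/integrableP; split; first by apply/measurable_EFinP; exact: mT.
  have TG0 x : 0 <= T G x by apply: sumr_ge0 => k _; rewrite mulr_ge0.
  under eq_integral do rewrite /= ger0_norm //.
  rewrite -pos //; have /integrableP[_] := iG.
  by under eq_integral do rewrite /= ger0_norm //.
have FpF x : Fp x <= `|F x| by rewrite ge_max ler_norm normr_ge0.
have FnF x : Fn x <= `|F x| by rewrite ge_max -normrN ler_norm normr_ge0.
have [ip ip'] := iP Fp mFp Fp0 FpF; have [im im'] := iP Fn mFn Fn0 FnF.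
have TE x : T F x = T Fp x - T Fn x.
  by rewrite /T -sumrB; apply: eq_bigr => k _; rewrite FE mulrBr.
rewrite /Rintegral; congr fine.
under eq_integral do rewrite FE.
under [RHS]eq_integral do rewrite -/(T F _) TE.
by rewrite !integralB_EFin // !pos.
Qed.

End TranslateIntegrals.

(** * Decomposition of a function into components on [nu] *)

Section StackedTranslates.
Context {R : realType} (nu mu : probability R R) (Gam : set R) (n : nat)
  (w s t : 'I_n -> R).
Hypothesis w_gt0 : forall k, 0 < w k.
Hypothesis muI : forall F : R -> \bar R, measurable_fun setT F ->
  (forall x, 0 <= F x)%E ->
  (\int[mu]_x F x = \sum_(k < n) (w k)%:E * \int[nu]_x F (x + s k)%R)%E.

Definition energy (rho : set R -> \bar R) (f : R -> R[i]) : \bar R :=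
  (\int[rho]_x (nsq (f x))%:E)%E.

(** Used with two matrices: the inverse of [twist_mx], giving the components along which [f] is
    expanded, and [analysis_mx], giving the functions that carry its Fourier coefficients. *)
Definition untwist (A : 'M[R[i]]_n) (f : R -> R[i]) (j : 'I_n) (x : R) : R[i] :=
  conjc (cexp (t j) x) * \sum_k A j k * f (x + s k).

Definition twisted (B : 'M[R[i]]_n) (u : 'I_n -> R -> R[i]) (f : R -> R[i]) :=
  forall x k, f (x + s k) = \sum_j B k j * (cexp (t j) x * u j x).

(** At each fixed [x] this is a linear system in the values [cexp (t j) x * u j x]; [A] solves it,
    and the conjugate exponential removes the unimodular factor. *)
Lemma untwistK (A B : 'M[R[i]]_n) u f : A *m B = 1%:M -> twisted B u f ->
  forall j x, untwist A f j x = u j x.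
Proof.
move=> AB fE j x; rewrite /untwist.
under eq_bigr do rewrite fE mulr_sumr.
rewrite exchange_big (bigD1 j) // [X in _ * (_ + X)]big1 => [|i ij].
  under eq_bigr do rewrite mulrA.
  rewrite -mulr_suml addr0.
  have := congr1 (fun M : 'M[R[i]]_n => M j j) AB; rewrite !mxE eqxx => ->.
  by rewrite mul1r mulrA [_^*%C * _]mulrC cexp_conjK mul1r.
under eq_bigr do rewrite mulrA.
rewrite -mulr_suml.
have := congr1 (fun M : 'M[R[i]]_n => M j i) AB; rewrite !mxE eq_sym (negbTE ij) => ->.
by rewrite mul0r.
Qed.

Lemma twisted_untwist (A B : 'M[R[i]]_n) f : B *m A = 1%:M ->
  twisted B (untwist A f) f.
Proof.
move=> BA x k; rewrite /untwist.
under eq_bigr do rewrite [cexp _ _ * _]mulrA cexp_conjK mul1r mulr_sumr.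
rewrite exchange_big (bigD1 k) // [X in _ = _ + X]big1 => [|i ik].
  under eq_bigr do rewrite mulrA.
  rewrite -mulr_suml addr0.
  by have := congr1 (fun M : 'M[R[i]]_n => M k k) BA; rewrite !mxE eqxx => ->; rewrite mul1r.
under eq_bigr do rewrite mulrA.
rewrite -mulr_suml.
have := congr1 (fun M : 'M[R[i]]_n => M k i) BA; rewrite !mxE eq_sym (negbTE ik) => ->.
by rewrite mul0r.
Qed.

Lemma untwistB A f g j x :
  untwist A (fun y => f y - g y) j x = untwist A f j x - untwist A g j x.
Proof.
rewrite /untwist -mulrBr -sumrB; congr (_ * _).
by apply: eq_bigr => k _; rewrite mulrBr.
Qed.

Lemma cmeasurable_untwist A f j : cmeasurable f -> cmeasurable (untwist A f j).
Proof.
move=> mf; apply: cmeasurableM; first exact/cmeasurable_conj/cmeasurable_cexp.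
apply: cmeasurable_sum => k; apply: cmeasurableM; first exact: cmeasurable_cst.
exact: cmeasurable_shift.
Qed.

Lemma measurable_energy (f : R -> R[i]) : cmeasurable f ->
  measurable_fun setT (fun x : R => (nsq (f x))%:E).
Proof. by move=> mf; apply/measurable_EFinP; exact: measurable_nsq. Qed.

Lemma energy_mu f : cmeasurable f ->
  energy mu f = (\int[nu]_x (\sum_k w k * nsq (f (x + s k)))%:E)%E.
Proof.
move=> mf; rewrite /energy (muI (fun x => (nsq (f x))%:E)); last first.
- by move=> x; rewrite lee_fin nsq_ge0.
- exact: measurable_energy.
under [RHS]eq_integral do rewrite -sumEFin.
have mk (k : 'I_n) : measurable_fun setT (fun x : R => (nsq (f (x + s k)))%:E).
  by apply: measurable_energy; exact: cmeasurable_shift.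
rewrite ge0_integral_sum //.
- apply: eq_bigr => k _; under [RHS]eq_integral do rewrite EFinM.
  rewrite ge0_integralZl_EFin //; first by move=> x _; rewrite lee_fin nsq_ge0.
  exact: ltW.
- move=> k; under eq_fun do rewrite EFinM; exact: measurable_funeM.
- by move=> k x _; rewrite lee_fin mulr_ge0 ?nsq_ge0 // ltW.
Qed.

Lemma sum_energy (u : 'I_n -> R -> R[i]) : (forall j, cmeasurable (u j)) ->
  (\sum_j energy nu (u j) = \int[nu]_x (\sum_j nsq (u j x))%:E)%E.
Proof.
move=> mu'; under [RHS]eq_integral do rewrite -sumEFin.
rewrite ge0_integral_sum // => [j|j x _]; first exact: measurable_energy.
by rewrite lee_fin nsq_ge0.
Qed.

Lemma le_integral_scaled (K : R) (a b : R -> R) :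
  0 < K -> measurable_fun setT a -> measurable_fun setT b ->
  (forall x, 0 <= a x) -> (forall x, 0 <= b x) -> (forall x, a x <= K * b x) ->
  (\int[nu]_x (a x)%:E <= K%:E * \int[nu]_x (b x)%:E)%E.
Proof.
move=> K0 /measurable_EFinP ma /measurable_EFinP mb a0 b0 ab.
rewrite -ge0_integralZl_EFin //; last 2 first.
- by move=> x _; rewrite lee_fin.
- exact: ltW.
apply: ge0_le_integral => //.
- by move=> x _; rewrite lee_fin.
- exact: measurable_funeM.
- by move=> x _; rewrite -EFinM lee_fin.
Qed.

Lemma measurable_sum_nsq (v : 'I_n -> R) (u : 'I_n -> R -> R[i]) :
  (forall j, cmeasurable (u j)) ->
  measurable_fun setT (fun x : R => \sum_j v j * nsq (u j x)).
Proof.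
move=> mu'; apply: measurable_sum => j.
by apply: measurable_funM; [exact: measurable_cst|exact: measurable_nsq].
Qed.

(** Unimodular factors do not change [nsq], so [sum_nsq_le] applies at each [x] and is then
    integrated against [nu]. [energy_twisted_le] gives the opposite bound in the same way. *)
Lemma energy_untwist_le A : exists2 K : R, 0 < K &
  forall f, cmeasurable f ->
    (\sum_j energy nu (untwist A f j) <= K%:E * energy mu f)%E.
Proof.
have [K K0 HK] := sum_nsq_le _ _ (fun=> 1) w A w_gt0.
exists K => // f mf; rewrite sum_energy; last by move=> j; exact: cmeasurable_untwist.
rewrite energy_mu //; apply: le_integral_scaled => //.
- under eq_fun do under eq_bigr do rewrite -[nsq _]mul1r.
  by apply: measurable_sum_nsq => j; exact: cmeasurable_untwist.
- by apply: (measurable_sum_nsq w) => k; exact: cmeasurable_shift.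
- by move=> x; apply: sumr_ge0 => j _; exact: nsq_ge0.
- by move=> x; apply: sumr_ge0 => j _; rewrite mulr_ge0 ?nsq_ge0 // ltW.
move=> x; apply: le_trans _ (HK (fun k => f (x + s k))).
apply: ler_sum => j _.
by rewrite /untwist nsqM nsq_conj nsq_cexp.
Qed.

Lemma energy_twisted_le B : exists2 K : R, 0 < K &
  forall u f, (forall j, cmeasurable (u j)) -> cmeasurable f -> twisted B u f ->
    (energy mu f <= K%:E * \sum_j energy nu (u j))%E.
Proof.
have [K K0 HK] := sum_nsq_le _ _ w (fun=> 1) B (fun=> ltr01).
exists K => // u f mu' mf fE; rewrite sum_energy // energy_mu //.
apply: le_integral_scaled => //.
- by apply: (measurable_sum_nsq w) => k; exact: cmeasurable_shift.
- under eq_fun do under eq_bigr do rewrite -[nsq _]mul1r.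
  exact: measurable_sum_nsq.
- by move=> x; apply: sumr_ge0 => j _; rewrite mulr_ge0 ?nsq_ge0 // ltW.
- by move=> x; apply: sumr_ge0 => j _; exact: nsq_ge0.
move=> x; under eq_bigr do rewrite fE.
apply: le_trans (HK (fun j => cexp (t j) x * u j x)) _.
apply: ler_wpM2l; [exact: ltW|apply: ler_sum => j _].
by rewrite mul1r nsqM nsq_cexp mul1r.
Qed.

(** * The union of the shifted spectra and its finite partial sums *)

Hypothesis Gam_period : forall g k, Gam g -> cexp g (s k) = 1.
Hypothesis Gam_disjoint : forall l i j, Gam (l - t i) -> Gam (l - t j) -> i = j.

Definition twist_mx : 'M[R[i]]_n := \matrix_(k, j) cexp (t j) (s k).
Hypothesis twist_unit : twist_mx \in unitmx.

Definition stacked : set R := [set l | exists j, Gam (l - t j)].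

Definition slice (F : seq R) (j : 'I_n) : seq R :=
  [seq l - t j | l <- F & `[< Gam (l - t j) >]].

(** [undup] guarantees the uniqueness that [has_expansion] asks of a finite set, whatever the lists
    [G j] are. *)
Definition stack (G : 'I_n -> seq R) : seq R :=
  undup [seq g + t j | j <- enum 'I_n, g <- G j].

Lemma mem_slice F j g : (g \in slice F j) = (g + t j \in F) && `[< Gam g >].
Proof.
apply/mapP/andP => [[l]|[gF gG]].
  by rewrite mem_filter => /andP[lG lF] ->; rewrite subrK.
by exists (g + t j); rewrite ?mem_filter addrK // gG.
Qed.

Lemma uniq_slice F j : uniq F -> uniq (slice F j).
Proof. by move=> uF; rewrite map_inj_uniq ?filter_uniq //; exact: addIr. Qed.

Lemma mem_stack G l : l \in stack G <-> exists j, l - t j \in G j.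
Proof.
rewrite mem_undup; split.
  by case/allpairsPdep => j [g [_ gG ->]]; exists j; rewrite addrK.
by case=> j lG; apply/allpairsPdep; exists j, (l - t j); rewrite mem_enum subrK.
Qed.

(** For [l = g + t j] with [g] in [Gam], [cexp g (s k) = 1] leaves the factor [cexp (t j) (s k)],
    which is the matrix entry. Each [l] lies in exactly one layer, so the sum over [j] counts it
    once. *)
Lemma psum_twisted c F : (forall l, l \in F -> stacked l) ->
  twisted twist_mx (fun j x => toC (psum (fun g => c (g + t j)) (slice F j) x))
    (fun x => toC (psum c F x)).
Proof.
move=> FL x k; rewrite toC_psum.
have E j : twist_mx k j * (cexp (t j) x *
    toC (psum (fun g => c (g + t j)) (slice F j) x)) =
    \sum_(l <- F) (if `[< Gam (l - t j) >] then toC (c l) * cexp l (x + s k) else 0).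
  rewrite toC_psum big_map big_filter -big_mkcond /= !mulr_sumr.
  apply: eq_bigr => l /asboolP lG; rewrite mxE subrK.
  have -> : cexp l (x + s k) = cexp (l - t j) x * cexp (t j) x * cexp (t j) (s k).
    by rewrite -[l in LHS](subrK (t j)) (cexpDl (l - t j)) !cexpDr (Gam_period _ _ lG) mulr1 mulrA.
  by ring.
under [RHS]eq_bigr do rewrite E.
rewrite exchange_big /= !big_seq; apply: eq_bigr => l /FL[j lG].
rewrite (bigD1 j) //= (asboolT lG) big1 ?addr0 // => i ij.
by case: asboolP => // /Gam_disjoint/(_ lG) /eqP; rewrite (negbTE ij).
Qed.

(** * Transfer of the basis property *)

Lemma dist2E (rho : {measure set R -> \bar R}) (f g : R -> R * R) :
  dist2 rho f g = energy rho (fun x => toC (f x) - toC (g x)).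
Proof. by []. Qed.

Lemma cL2_measurable (rho : {measure set R -> \bar R}) f :
  cL2 rho f -> cmeasurable (fun x => toC (f x)).
Proof. by case. Qed.

Lemma energy_ge0 (rho : {measure set R -> \bar R}) f : (0 <= energy rho f)%E.
Proof. by apply: integral_ge0 => x _; rewrite lee_fin nsq_ge0. Qed.

Lemma energy_untwist_le1 A j : exists2 K : R, 0 < K &
  forall f, cmeasurable f -> (energy nu (untwist A f j) <= K%:E * energy mu f)%E.
Proof.
have [K K0 HK] := energy_untwist_le A; exists K => // f mf.
apply: le_trans (HK f mf).
by rewrite (bigD1 j) //= leeDl // sume_ge0 // => i _; exact: energy_ge0.
Qed.

Lemma cL2_untwist A f j :
  cL2 mu f -> cL2 nu (fun x => ofC (untwist A (fun x => toC (f x)) j x)).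
Proof.
move=> fL2; have mf := cL2_measurable _ _ fL2; case: fL2 => _ _ foo.
have [m1 m2] := cmeasurable_untwist A _ j mf; split=> //.
have [K K0 HK] := energy_untwist_le1 A j.
by apply: le_lt_trans (HK _ mf) _; rewrite lte_mul_pinfty // lee_fin ltW.
Qed.

Local Notation component f j :=
  (fun x => ofC (untwist (invmx twist_mx) (fun x => toC (f x)) j x)).

(** [untwist] is linear and bounded, and it sends a partial sum over [stacked] to the partial sum
    over its [j]-th slice, so convergence passes to components. *)
Lemma expansion_component f c j : cmeasurable (fun x => toC (f x)) ->
  has_expansion mu stacked f c ->
  has_expansion nu Gam (component f j) (fun g => c (g + t j)).
Proof.
move=> mf fc e e0; have [K K0 HK] := energy_untwist_le1 (invmx twist_mx) j.
have [F0 [F0L HF0]] := fc (e / K) (divr_gt0 e0 K0).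
(* The slices of [F0] in all layers are collected, not only the [j]-th: copying [F] into every layer
   then yields a set [F'] that contains [F0] and whose [j]-th slice is [F] up to order. *)
exists (flatten [seq slice F0 i | i <- enum 'I_n]); split.
  by move=> g /flatten_mapP[i _]; rewrite mem_slice => /andP[_ /asboolP].
move=> F uF FG F0F; pose F' := stack (fun=> F).
have F'L l : l \in F' -> stacked l.
  by case/mem_stack => i /FG lG; exists i.
have F0F' l : l \in F0 -> l \in F'.
  move=> lF0; have [i lG] := F0L _ lF0; apply/mem_stack; exists i; apply: F0F.
  apply/flatten_mapP; exists i; rewrite ?mem_enum //.
  by rewrite mem_slice subrK lF0; exact/asboolP.
have FF' : perm_eq (slice F' j) F.
  apply: uniq_perm => //; first exact/uniq_slice/undup_uniq.
  move=> g; rewrite mem_slice; apply/andP/idP => [[/mem_stack[i gF] /asboolP gG]|gF].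
    suff ji : j = i by rewrite -ji addrK in gF.
    by apply: (Gam_disjoint (g + t j)); [rewrite addrK|exact: FG].
  by split; [apply/mem_stack; exists j; rewrite addrK|exact/asboolP/FG].
have := HF0 F' (undup_uniq _) F'L F0F'; rewrite !dist2E => dF'.
rewrite -[e](divfK (lt0r_neq0 K0)) mulrC EFinM.
have mh : cmeasurable (fun x => toC (f x) - toC (psum c F' x)).
  exact/cmeasurableB/cmeasurable_psum.
rewrite (_ : (fun x => _) =
    untwist (invmx twist_mx) (fun x => toC (f x) - toC (psum c F' x)) j).
  by apply: le_lt_trans (HK _ mh) _; rewrite lte_pmul2l.
apply/funext => x; rewrite untwistB ofCK; congr (_ - _).
rewrite (untwistK _ _ _ _ (mulVmx twist_unit) (psum_twisted c F' F'L)).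
by rewrite !toC_psum; apply: perm_big; rewrite perm_sym.
Qed.

(** The choice made by [pick] is unambiguous because the layers are disjoint; [(0, 0)] is the value
    off [stacked]. *)
Definition stacked_coef (a : 'I_n -> R -> R * R) (l : R) : R * R :=
  if [pick j | `[< Gam (l - t j) >]] is Some j then a j (l - t j) else (0, 0).

Lemma stacked_coefE a j g : Gam g -> stacked_coef a (g + t j) = a j g.
Proof.
move=> gG; have gG' : Gam (g + t j - t j) by rewrite addrK.
rewrite /stacked_coef; case: pickP => [i /asboolP iG|/(_ j)/asboolP//].
by rewrite -(Gam_disjoint _ _ _ gG' iG) addrK.
Qed.

Lemma expansion_stacked f a : cmeasurable (fun x => toC (f x)) ->
  (forall j, has_expansion nu Gam (component f j) (a j)) ->
  has_expansion mu stacked f (stacked_coef a).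
Proof.
move=> mf fa e e0; have [K K0 HK] := energy_twisted_le twist_mx.
(* With [n.+1] in place of [n], the total error is at most [K * n * d = e * n / n.+1], strictly
   below [e], and [n = 0] causes no division by zero. *)
pose d := e / (K * n.+1%:R).
have d0 : 0 < d by rewrite divr_gt0 // mulr_gt0.
have /choice[G0 HG0] := fun j => fa j d d0.
exists (stack G0); split.
  by move=> l /mem_stack[j lG0]; exists j; exact: (HG0 j).1.
move=> F uF FL G0F; rewrite dist2E.
(* [u j] is the error of the [j]-th component; the error of [f] is the twisted combination of
   these. *)
pose u j x := untwist (invmx twist_mx) (fun x => toC (f x)) j x -
  toC (psum (a j) (slice F j) x).
have mu' j : cmeasurable (u j).
  by apply: cmeasurableB; [exact: cmeasurable_untwist|exact: cmeasurable_psum].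
have tw : twisted twist_mx u (fun x => toC (f x) - toC (psum (stacked_coef a) F x)).
  move=> x k; rewrite (twisted_untwist _ _ (fun x => toC (f x)) (mulmxV twist_unit)).
  rewrite (psum_twisted (stacked_coef a) F FL) -sumrB; apply: eq_bigr => j _.
  rewrite -!mulrBr; congr (_ * (_ * (_ - _))).
  rewrite !toC_psum !big_seq; apply: eq_bigr => g.
  by rewrite mem_slice => /andP[_ /asboolP gG]; rewrite stacked_coefE.
have mh : cmeasurable (fun x => toC (f x) - toC (psum (stacked_coef a) F x)).
  exact/cmeasurableB/cmeasurable_psum.
apply: le_lt_trans (HK u _ mu' mh tw) _.
have ud j : (energy nu (u j) <= d%:E)%E.
  have [_ /(_ (slice F j) (uniq_slice _ _ uF))] := HG0 j.
  move=> H; apply/ltW; have {H} := H _ _; rewrite dist2E.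
  have -> : (fun x => toC (component f j x) - toC (psum (a j) (slice F j) x)) = u j.
    by apply/funext => x; rewrite ofCK.
  apply.
    by move=> g; rewrite mem_slice => /andP[_ /asboolP].
  move=> g gG0; rewrite mem_slice; apply/andP; split.
    by apply: G0F; apply/mem_stack; exists j; rewrite addrK.
  by apply/asboolP; exact: (HG0 j).1.
have : (\sum_j energy nu (u j) <= (\sum_(j < n) d)%:E)%E.
  by rewrite -sumEFin; apply: lee_sum.
rewrite sumr_const card_ord => H.
apply: le_lt_trans (lee_wpmul2l _ H) _; first by rewrite lee_fin ltW.
rewrite -EFinM lte_fin -mulr_natl /d.
rewrite [X in X < _](_ : _ = e * (n%:R / n.+1%:R)).
  by rewrite gtr_pMr // ltr_pdivrMr // mul1r ltr_nat.
field; apply/andP; split; last exact: lt0r_neq0.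
by rewrite nat1r pnatr_eq0.
Qed.

Lemma exp_basis_stacked : exp_basis nu Gam -> exp_basis mu stacked.
Proof.
move=> bG f fL2; have mf := cL2_measurable _ _ fL2.
have bj j := bG _ (cL2_untwist (invmx twist_mx) f j fL2).
split.
  have /choice[a fa] := fun j => (bj j).1.
  by exists (stacked_coef a); exact: expansion_stacked.
move=> c1 c2 fc1 fc2 l [j lG].
have := (bj j).2 _ _ (expansion_component _ _ j mf fc1)
  (expansion_component _ _ j mf fc2) _ lG.
by rewrite subrK.
Qed.

(** * Transfer of the frame inequalities *)

Definition analysis_mx : 'M[R[i]]_n :=
  \matrix_(j, k) ((w k)%:C%C * conjc (twist_mx k j)).

Definition synthesis_mx : 'M[R[i]]_n :=
  \matrix_(k, j) (((w k)^-1)%:C%C * conjc (invmx twist_mx j k)).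

(** With V for [twist_mx], the two matrices are [diag(w)^-1 (V^-1)^*] and [V^* diag(w)]; the product
    reduces to the conjugate of an entry of [V V^-1]. *)
Lemma synthesis_analysisK : synthesis_mx *m analysis_mx = 1%:M.
Proof.
apply/matrixP => k l; rewrite !mxE.
transitivity (((w k)^-1)%:C%C * (w l)%:C%C *
    conjc ((twist_mx *m invmx twist_mx) l k)).
  rewrite [in RHS]mxE rmorph_sum /= mulr_sumr; apply: eq_bigr => j _.
  by rewrite !mxE rmorphM /=; ring.
rewrite mulmxV // mxE eq_sym; case: eqVneq => [->|_]; last by rewrite rmorph0 mulr0.
by rewrite rmorph1 mulr1 -rmorphM /= mulVf // gt_eqF.
Qed.

Lemma fcoefReE (rho : {measure set R -> \bar R}) f l :
  fcoefRe rho f l = Rintegral rho setT (fun x => Re (toC (f x) * conjc (cexp l x))).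
Proof. by congr (Rintegral rho setT _); apply/funext => x /=; ring. Qed.

Lemma fcoefImE (rho : {measure set R -> \bar R}) f l :
  fcoefIm rho f l = Rintegral rho setT (fun x => Im (toC (f x) * conjc (cexp l x))).
Proof. by congr (Rintegral rho setT _); apply/funext => x /=; ring. Qed.

Lemma integrable_le_nsq (a : R -> R) f : cL2 mu f -> measurable_fun setT a ->
  (forall x, a x ^+ 2 <= nsq (toC (f x))) -> mu.-integrable setT (EFin \o a).
Proof.
move=> fL2 ma af; have mf := cL2_measurable _ _ fL2; have [_ _ foo] := fL2.
have i1 : mu.-integrable setT (EFin \o (fun x => nsq (toC (f x)))).
  apply/integrableP; split; first exact: measurable_energy.
  by under eq_integral do rewrite /= ger0_norm ?nsq_ge0 //.
have i2 := integrableD measurableT (finite_measure_integrable_cst mu 1 measurableT) i1.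
apply: le_integrable i2 => //; first exact/measurable_EFinP.
move=> x _; rewrite /= lee_fin [leRHS]ger0_norm; last first.
  by rewrite addr_ge0 ?nsq_ge0.
have := af x; rewrite -real_normK ?num_real // => h.
(* The dominating function is [1 + |f|^2], integrable since [mu] is finite; expanding the square
   gives [|a| <= 1 + a^2]. *)
have := sqr_ge0 (`|a x| - 1); have := normr_ge0 (a x); nra.
Qed.

(** Writing the [mu]-integral over the translates, [cexp g (s k) = 1] lets the conjugate of
    [cexp g x] factor out; what remains is row [j] of [analysis_mx] applied to the translates of
    [f]. *)
Lemma fcoef2_stacked f g j : cL2 mu f -> Gam g ->
  fcoef2 mu f (g + t j) =
  fcoef2 nu (fun x => ofC (untwist analysis_mx (fun x => toC (f x)) j x)) g.
Proof.
move=> fL2 gG; have mf := cL2_measurable _ _ fL2.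
pose h x := toC (f x) * conjc (cexp (g + t j) x).
have [mRe mIm] : cmeasurable h.
  by apply: cmeasurableM => //; exact/cmeasurable_conj/cmeasurable_cexp.
have nh x : nsq (h x) = nsq (toC (f x)).
  by rewrite nsqM nsq_conj nsq_cexp mulr1.
have hE x : toC (ofC (untwist analysis_mx (fun x => toC (f x)) j x)) *
    conjc (cexp g x) = \sum_k (w k)%:C%C * h (x + s k).
  rewrite ofCK /untwist mulr_sumr mulr_suml; apply: eq_bigr => k _.
  rewrite /h cexpDl !cexpDr (Gam_period _ _ gG) mulr1 !mxE !rmorphM /=; ring.
have w0 k : 0 <= w k by exact: ltW.
rewrite /fcoef2 !fcoefReE !fcoefImE.
rewrite (Rintegral_translates w0 muI (fun x => Re (h x))); last first.
  apply: (integrable_le_nsq _ _ fL2) => // x.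
  by rewrite -nh /nsq lerDl sqr_ge0.
rewrite (Rintegral_translates w0 muI (fun x => Im (h x))); last first.
  apply: (integrable_le_nsq _ _ fL2) => // x.
  by rewrite -nh /nsq lerDr sqr_ge0.
congr (Rintegral nu setT _ ^+ 2 + Rintegral nu setT _ ^+ 2); apply/funext => x.
  by rewrite hE Re_sum; apply: eq_bigr => k _; rewrite ReMc /=; ring.
by rewrite hE Im_sum; apply: eq_bigr => k _; rewrite ImMc /=; ring.
Qed.

(** By disjointness exactly one layer indicator is nonzero at each [l]; the sums are exchanged and
    each layer is reindexed by its translation. *)
Lemma esum_stacked (a : R -> \bar R) : (forall l, 0 <= a l)%E ->
  (\esum_(l in stacked) a l = \sum_j \esum_(g in Gam) a (g + t j)%R)%E.
Proof.
move=> a0.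
transitivity (\esum_(l in stacked)
    \sum_j (if l \in [set l : R | Gam (l - t j)%R] then a l else 0))%E.
  apply: eq_esum => l [j lG]; rewrite (bigD1 j) //= mem_set // big1 ?adde0 // => i ij.
  by case: ifPn => // /set_mem/(Gam_disjoint _ _ _ lG)/esym/eqP; rewrite (negbTE ij).
rewrite esum_sum => [|l j _ _]; last by case: ifP.
apply: eq_bigr => j _; rewrite -esum_mkcondr.
rewrite (_ : _ `&` _ = (fun g : R => g + t j) @` Gam).
  by rewrite esum_image // => x y _ _; exact: addIr.
apply/seteqP; split => [l [_ lG]|_ [g gG <-]].
  by exists (l - t j) => //; rewrite subrK.
by split; [exists j|]; rewrite /= addrK.
Qed.

Lemma exp_frame_stacked : exp_frame nu Gam -> exp_frame mu stacked.
Proof.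
move=> [A [B [A0 B0 HAB]]].
have [K K0 HK] := energy_untwist_le analysis_mx.
have [L L0 HL] := energy_twisted_le synthesis_mx.
(* [L] bounds the energy of [f] by that of its analysis components, which weakens the lower bound;
   [K] bounds the converse way and enters the upper one. *)
exists (A / L), (B * K); split; [exact: divr_gt0|exact: mulr_gt0|].
move=> f fL2; have mf := cL2_measurable _ _ fL2.
pose h j x := untwist analysis_mx (fun x => toC (f x)) j x.
have mh j : cmeasurable (h j) by exact: cmeasurable_untwist.
have fh : (energy mu (fun x => toC (f x)) <= L%:E * \sum_j energy nu (h j))%E.
  by apply: HL => //; exact/twisted_untwist/synthesis_analysisK.
have hf : (\sum_j energy nu (h j) <= K%:E * energy mu (fun x => toC (f x)))%E.
  exact: HK.
have c2 l : (0 <= (fcoef2 mu f l)%:E)%E by rewrite lee_fin addr_ge0 ?sqr_ge0.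
rewrite (esum_stacked (fun l => (fcoef2 mu f l)%:E)) //.
have hE j : (\esum_(g in Gam) (fcoef2 mu f (g + t j))%:E =
    \esum_(g in Gam) (fcoef2 nu (fun x => ofC (h j x)) g)%:E)%E.
  by apply: eq_esum => g gG; rewrite fcoef2_stacked.
under eq_bigr do rewrite hE.
have HABj j := HAB _ (cL2_untwist analysis_mx f j fL2).
have e0 j : xpredT j -> (0 <= energy nu (h j))%E by move=> _; exact: energy_ge0.
split.
  apply: (@le_trans _ _ (A%:E * \sum_j energy nu (h j))%E).
    rewrite EFinM -muleA; apply: lee_wpmul2l; first by rewrite lee_fin ltW.
    by rewrite muleC lee_pdivrMr // muleC.
  by rewrite ge0_sume_distrr //; apply: lee_sum => j _; exact: (HABj j).1.
apply: (@le_trans _ _ (B%:E * \sum_j energy nu (h j))%E).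
  by rewrite ge0_sume_distrr //; apply: lee_sum => j _; exact: (HABj j).2.
by rewrite EFinM -muleA; apply: lee_wpmul2l => //; rewrite lee_fin ltW.
Qed.

Lemma RSpectrum_stacked : RSpectrum nu Gam -> RSpectrum mu stacked.
Proof.
by move=> [bG fG]; split; [exact: exp_basis_stacked|exact: exp_frame_stacked].
Qed.

End StackedTranslates.

(** * Choice of the shifts and invertibility of the Vandermonde matrix *)

Lemma cexp_int {R : realType} (l x : R) (z : int) : l * x = z%:~R -> cexp l x = 1.
Proof.
have c1 (y : R) : cexp y 1 = cexp 1 y by rewrite /cexp /ang; congr (cos _ +i* sin _)%C; ring.
have nat1 m : cexp (m%:R : R) 1 = 1.
  rewrite -[m%:R]mulr1 cexpMn /cexp /ang !mulr1 mulr_natl cos2pi sin2pi.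
  by rewrite -[(_ +i* _)%C]/(1 : R[i]) expr1n.
have -> : cexp l x = cexp (l * x) 1 by rewrite /cexp /ang; congr (cos _ +i* sin _)%C; ring.
move=> ->; case: z => m; first exact: nat1.
rewrite NegzE mulrNz; have := nat1 m.+1; rewrite /cexp /ang.
by rewrite mulrN mulNr cosN sinN => -[-> ->]; rewrite oppr0.
Qed.

Lemma Vandermonde_unit {F : fieldType} {n : nat} (a : 'rV[F]_n) :
  injective (a 0) -> Vandermonde n a \in unitmx.
Proof.
move=> ainj; rewrite unitmxE det_Vandermonde unitfE.
apply/prodf_neq0 => i _; apply/prodf_neq0 => j ij.
by rewrite subr_eq0; apply: contraTneq ij => /ainj ->; rewrite ltnn.
Qed.

Theorem theorem5p2 (R : realType) (nu : probability R R) (Gam : set R)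
  (q : nat) (C : seq nat) (p : nat -> R) (eta mu : probability R R) :
  msupport nu `<=` `[0%R, 1%R] ->
  RSpectrum nu Gam ->
  (0 < q)%N ->
  (forall g, Gam g -> exists z : int, q%:R * g = z%:~R) ->
  uniq C ->
  (forall c, c \in C -> 0 < p c) ->
  \sum_(c <- C) p c = 1 ->
  (forall A, measurable A ->
     eta A = (\sum_(c <- C) (p c)%:E * \d_((q * c)%:R : R) A)%E) ->
  (forall A, measurable A -> mu A = mconv eta nu A) ->
  RSpectral mu.
Proof.
move=> _ nuG q0 Gint uC p0 _ etaE muE.
pose n := size C; pose c (k : 'I_n) := nth 0%N C k.
pose w k := p (c k); pose s k : R := (q * c k)%:R.
pose M := (\max_(x <- C) x + n).+1.
(* The factor 2 keeps the angles 2 pi d s_k in [0, pi], where cos is injective;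
   the term n in M makes |t_i - t_j| < 1 / q, so that the Gam + t_j are disjoint. *)
pose d : R := (q * (2 * M))%:R^-1.
pose t (j : 'I_n) : R := j%:R * d.
have cM k : (c k < M)%N.
  rewrite ltnS (leq_trans _ (leq_addr _ _)) //.
  by apply: leq_bigmax_seq => //; exact: mem_nth.
have c_inj : injective c.
  by move=> i j /eqP; rewrite nth_uniq // => /eqP ij; exact: val_inj.
have q0R : q%:R != 0 :> R by rewrite pnatr_eq0 -lt0n.
have M0R : M%:R != 0 :> R by rewrite pnatr_eq0.
have w0 k : 0 < w k by apply: p0; exact: mem_nth.
have muI := integral_conv_discrete (fun k => ltW (w0 k)) (s := s) _ muE.
exists (stacked Gam n t); apply: (RSpectrum_stacked nu mu Gam n w s t) => //.
- apply: muI => A mA; rewrite etaE // (big_nth 0%N) big_mkord.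
  by apply: eq_bigr.
- move=> g k /Gint[z gz]; apply: (@cexp_int _ _ _ (z * c k)).
  by rewrite /s natrM mulrA [g * _]mulrC gz intrM.
(* Multiplying [t j - t i] by [q] gives [2 * M * (z1 - z2) = j - i]; since [|j - i| < n <= 2 * M],
   both sides vanish. *)
- move=> l i j /Gint[z1 e1] /Gint[z2 e2].
  have : ((2 * M)%:Z * (z1 - z2))%:~R = (j%:Z - i%:Z)%:~R :> R.
    rewrite intrM !intrB -e1 -e2 /t /d !natrM.
    by field; rewrite q0R M0R.
  move/intr_inj => e; apply/val_inj => /=.
  have := ltn_ord i; have := ltn_ord j; rewrite /M in e *.
  have [D0|D0|D0] := ltgtP (z1 - z2) 0; nia.
have -> : twist_mx n s t = (Vandermonde n (\row_k cexp d (s k)))^T.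
  by apply/matrixP => k j; rewrite !mxE /t cexpMn.
(* The nodes [cexp d (s k)] must be distinct. Their real parts suffice: the angles are
   [pi * (c k / M)] with [c k < M]. *)
rewrite unitmx_tr; apply: Vandermonde_unit => i j; rewrite !mxE => -[+ _].
have angE k : ang d (s k) = pi * ((c k)%:R / M%:R).
  by rewrite /ang /d /s !natrM; field; rewrite q0R M0R.
have angI k : ang d (s k) \in `[0, pi].
  rewrite angE in_itv /= mulr_ge0 ?pi_ge0 ?divr_ge0 //=.
  by rewrite ler_piMr ?pi_ge0 // ler_pdivrMr ?ltr0n // mul1r ler_nat ltnW.
move=> /(cos_inj (angI i) (angI j)); rewrite !angE => /(mulfI (lt0r_neq0 (pi_gt0 R))).
by move=> /(mulIf (invr_neq0 M0R)) /eqP; rewrite eqr_nat => /eqP /c_inj.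
Qed.
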